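(* Let $\mathcal{S}$ be an action-based randomization mechanism and let $K=|\mathcal{X}/\equiv|$ be the number of indistinguishability classes. Then: (1) for $U=H$ (Shannon entropy), $C(\mathcal{S})=\log K$; (2) for $U=E$ (error probability entropy), $C(\mathcal{S})=1-\frac{1}{K}$.
   Context: An action-based randomization mechanism is a 4-tuple $\mathcal{S}=(\mathcal{X},\mathcal{Y},Act,\{M_a:a\in Act\})$ where $\mathcal{X},\mathcal{Y},Act$ are finite nonempty sets and each $M_a$ is a stochastic $|\mathcal{X}|\times|\mathcal{Y}|$ matrix with entries $p_a(y|x)$. $\mathcal{P}$ is the set of probability distributions on $\mathcal{X}$. Shannon entropy: $H(p)=-\sum_x p(x)\log_2 p(x)$ ($0\log 0=0$); error probability entropy: $E(p)=1-\max_x p(x)$; $\log$ is base 2. A strategy is a partial function $\sigma:\mathcal{Y}^*\to Act$ with nonempty prefix-closed domain; finite if its domain is finite; $\sigma\backslash n$ is its restriction to sequences of length at most $n$. For a prior $p$ and finite $\sigma$, $p_\sigma$ on $\mathcal{X}\times\mathcal{Y}^*$ is: $p_\sigma(x,\varepsilon)=0$ and $p_\sigma(x,y_1,\dots,y_{j+1})=p(x)\prod_{i=1}^{j+1}p_{a_i}(y_i|x)$ with $a_i=\sigma(y_1\cdots y_{i-1})$ if $y_1\cdots y_j\in\mathrm{dom}(\sigma)$ and $y_1\cdots y_{j+1}\notin\mathrm{dom}(\sigma)$, else $0$. For $U\in\{H,E\}$ and $(X,Y)\sim p_\sigma$: $I_\sigma(\mathcal{S},p)=U(p)-\sum_{w:\,p_\sigma(w)>0}p_\sigma(w)U(p_\sigma(\cdot|w))$,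 where $p_\sigma(\cdot|w)$ is the conditional distribution of $X$ given $Y=w$; for infinite $\sigma$, $I_\sigma(\mathcal{S},p)=\lim_{l\to\infty}I_{\sigma\backslash l}(\mathcal{S},p)$. $I_\star(\mathcal{S},p)=\sup_\sigma I_\sigma(\mathcal{S},p)$ and the adaptive secrecy capacity is $C(\mathcal{S})=\sup_{p\in\mathcal{P}}I_\star(\mathcal{S},p)$ (for the chosen $U$). Indistinguishability: $x\equiv x'$ iff $p_a(\cdot|x)=p_a(\cdot|x')$ for all $a\in Act$. *)

(* Defs.v *)
(* MathComp-Analysis; reals are an arbitrary realType. *)
From HB Require Import structures.
From mathcomp Require Import all_boot all_order all_algebra.
From mathcomp Require Import all_classical all_reals all_analysis.

Set Implicit Arguments.
Unset Strict Implicit.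
Unset Printing Implicit Defensive.

Import Order.TTheory GRing.Theory Num.Theory.
Import numFieldNormedType.Exports.

Local Open Scope classical_set_scope.
Local Open Scope ring_scope.

Record fdist (R : realType) (T : finType) := FDist {
  pmf :> T -> R;
  pmf_ge0 : forall t, 0 <= pmf t;
  pmf_sum1 : \sum_(t : T) pmf t = 1
}.

(* [chan S a x y] is the entry p_a(y|x) of the stochastic matrix M_a. *)
Record mechanism (R : realType) (X Y Act : finType) := Mechanism {
  chan : Act -> X -> fdist R Y;
  inputs_nonempty : (0 < #|X|)%N;
  outputs_nonempty : (0 < #|Y|)%N;
  actions_nonempty : (0 < #|Act|)%N
}.

Section Entropies.
Variables (R : realType) (T : finType).

Definition log2 (x : R) : R := ln x / ln 2.

(* The convention 0 log 0 = 0 holds because of the factor [p x] = 0. *)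
Definition shannon_entropy (p : T -> R) : R := - \sum_(x : T) p x * log2 (p x).

(* The default value 0 of the iterated maximum is harmless: this is only used
   on probability distributions, which are nonnegative. *)
Definition error_entropy (p : T -> R) : R := 1 - \big[Num.max/0]_(x : T) p x.

End Entropies.

(* Partial functions Y^* -> Act are encoded with [option]. *)
Record strategy (Y Act : finType) := Strategy {
  choice_of :> seq Y -> option Act;
  strategy_nonempty : exists w, isSome (choice_of w);
  strategy_prefix_closed : forall u w,
    prefix u w -> isSome (choice_of w) -> isSome (choice_of u)
}.

Section Strategies.
Variables (Y Act : finType).

Definition strategy_dom (sigma : strategy Y Act) : set (seq Y) :=
  [set w | isSome (sigma w)].

Definition finite_strategy (sigma : strategy Y Act) : Prop :=
  finite_set (strategy_dom sigma).

Definition restrict_fun (sigma : strategy Y Act) (n : nat) (w : seq Y) :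
    option Act :=
  if (size w <= n)%N then sigma w else None.

Lemma restrict_nonempty sigma n : exists w, isSome (restrict_fun sigma n w).
Proof.
have [w sw] := strategy_nonempty sigma.
exists [::]; rewrite /restrict_fun /=.
exact: strategy_prefix_closed (prefix0s w) sw.
Qed.

Lemma restrict_prefix_closed sigma n u w :
  prefix u w -> isSome (restrict_fun sigma n w) ->
  isSome (restrict_fun sigma n u).
Proof.
rewrite /restrict_fun => uw; case: ifP => // wn sw.
rewrite (leq_trans (size_prefix uw) wn).
exact: strategy_prefix_closed uw sw.
Qed.

Definition restrict (sigma : strategy Y Act) (n : nat) : strategy Y Act :=
  Strategy (restrict_nonempty sigma n) (@restrict_prefix_closed sigma n).

End Strategies.

Section Capacity.
Variables (R : realType) (X Y Act : finType).
Variables (U : (X -> R) -> R) (S : mechanism R X Y Act).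

(* p_{a_i}(y_i|x) for w = y_1 ... y_k, where the 0-based [i] stands for i + 1
   and a_(i+1) = sigma(y_1 ... y_i).  The [None] branch is never reached in
   [joint], since the domain of sigma is prefix-closed. *)
Definition step_prob (sigma : strategy Y Act) (x : X) (w : seq Y)
    (i : 'I_(size w)) : R :=
  if sigma (take i w) is Some a then chan S a x (tnth (in_tuple w) i) else 0.

Definition joint (p : fdist R X) (sigma : strategy Y Act) (x : X) (w : seq Y) :
    R :=
  if [&& w != [::], isSome (sigma (take (size w).-1 w)) & ~~ isSome (sigma w)]
  then p x * \prod_(i < size w) step_prob sigma x i
  else 0.

Definition marginal (p : fdist R X) (sigma : strategy Y Act) (w : seq Y) : R :=
  \sum_(x : X) joint p sigma x w.

Definition conditional (p : fdist R X) (sigma : strategy Y Act) (w : seq Y) :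
    X -> R :=
  fun x => joint p sigma x w / marginal p sigma w.

(* The sum is over a finite set of words whenever sigma is finite, because Y
   is finite. *)
Definition finite_leakage (p : fdist R X) (sigma : strategy Y Act) : R :=
  U p - \sum_(w \in [set w | 0 < marginal p sigma w])
          marginal p sigma w * U (conditional p sigma w).

Definition leakage (p : fdist R X) (sigma : strategy Y Act) : R :=
  if `[< finite_strategy sigma >] then finite_leakage p sigma
  else limn (fun l => finite_leakage p (restrict sigma l)).

(* Suprema are taken in the extended reals, so that they are genuine suprema
   without any boundedness proviso. *)
Definition max_leakage (p : fdist R X) : \bar R :=
  ereal_sup [set (leakage p sigma)%:E | sigma in [set: strategy Y Act]].

Definition capacity : \bar R :=
  ereal_sup [set max_leakage p | p in [set: fdist R X]].

End Capacity.

Section Indistinguishability.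
Variables (R : realType) (X Y Act : finType) (S : mechanism R X Y Act).

Definition indist : rel X :=
  fun x x' => [forall a : Act, forall y : Y, chan S a x y == chan S a x' y].

Definition num_classes : nat := #|equivalence_partition indist [set: X]|.

End Indistinguishability.

(* Main.v *)
(* Upper bounds: the outcome depends on the input only through its class, so
   the likelihoods satisfy sum_w sum_C L_C(w) = K.  For Shannon entropy, the
   inequality ln t <= t - 1 applied to t = L(x,w) / (K m(w)), with m the law of
   the outcome, bounds I - log K by a chi-square type sum that is at most 0.
   For the error probability the expected posterior maximum V satisfies V <= 1
   and V <= K max p, so V - max p <= V (1 - 1/K) <= 1 - 1/K.
   Lower bounds: take the uniform prior on a set of class representatives and
   play all actions in turn for n rounds.  The residual Shannon entropy is at
   most a constant times the sum of the Bhattacharyya affinities of pairs of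
   distinct representatives, which decay geometrically in n, and it dominates
   the residual error probability up to the factor ln 2. *)
Require Import Defs.
From HB Require Import structures.
From mathcomp Require Import all_boot all_order all_algebra.
From mathcomp Require Import all_classical all_reals all_analysis.
From mathcomp Require Import ring lra.

Set Implicit Arguments.
Unset Strict Implicit.
Unset Printing Implicit Defensive.

Import Order.TTheory GRing.Theory Num.Theory.
Import numFieldNormedType.Exports.

Local Open Scope ring_scope.

(** * Elementary inequalities for the logarithm and the square root *)

Section RealInequalities.
Variable R : realType.
Implicit Types x : R.

Lemma ln_le_sub1 x : 0 < x -> ln x <= x - 1.
Proof.
by move=> x0; have := @le_ln1Dx R (x - 1); rewrite subrKC; apply; lra.
Qed.

Lemma ln2_gt0 : 0 < ln 2 :> R.
Proof. by rewrite ln_gt0 // ltr1n. Qed.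

Lemma ln_sqrtr x : 0 < x -> ln x = 2 * ln (Num.sqrt x).
Proof.
by move=> x0; rewrite -{1}(sqr_sqrtr (ltW x0)) lnXn ?sqrtr_gt0 // mulr_natl.
Qed.

Lemma sqrt_sum_le (I : Type) (s : seq I) (f : I -> R) :
  (forall i, 0 <= f i) ->
  Num.sqrt (\sum_(i <- s) f i) <= \sum_(i <- s) Num.sqrt (f i).
Proof.
move=> f0; elim: s => [|i s IH]; first by rewrite !big_nil sqrtr0.
rewrite !big_cons; apply: le_trans (lerD (lexx _) IH).
have s0 : 0 <= \sum_(j <- s) f j by apply: sumr_ge0.
rewrite -(@ler_pXn2r _ 2) ?nnegrE ?addr_ge0 ?sqrtr_ge0 //.
rewrite sqr_sqrtr ?addr_ge0 // sqrrD !sqr_sqrtr // lerD2r lerDl.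
by rewrite mulrn_wge0 // mulr_ge0 ?sqrtr_ge0.
Qed.

End RealInequalities.

(** * Comparison of the two entropies *)

Section Entropy.
Variables (R : realType) (X : finType).
Implicit Type c : X -> R.

Lemma ln2_shannon_entropy c :
  ln 2 * shannon_entropy c = - \sum_x c x * ln (c x).
Proof.
rewrite /shannon_entropy mulrN mulr_sumr; congr (- _); apply: eq_bigr => x _.
by rewrite /log2 mulrCA [ln 2 * _]mulrC divfK // gt_eqF ?ln2_gt0.
Qed.

(** On the support, [- ln (c x) >= 1 - c x >= 1 - M] with [M] the largest mass; average this against
    [c]. *)
Lemma error_entropy_le c : (forall x, 0 <= c x) -> \sum_x c x = 1 ->
  error_entropy c <= ln 2 * shannon_entropy c.
Proof.
move=> c0 c1; rewrite ln2_shannon_entropy /error_entropy.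
set M := \big[_/_]_x _.
have -> : 1 - M = \sum_x c x * (1 - M) by rewrite -mulr_suml c1 mul1r.
rewrite -sumrN; apply: ler_sum => x _.
have cM : c x <= M by apply: le_bigmax.
have [->|cx] := eqVneq (c x) 0; first by rewrite !mul0r oppr0.
have cx0 : 0 < c x by rewrite lt_def cx c0.
have := ler_wpM2l (c0 x) (ln_le_sub1 cx0).
have := ler_wpM2l (c0 x) cM; rewrite !mulrBr; lra.
Qed.

End Entropy.

(** * Posteriors and residual entropy of a joint mass function *)

Section Channel.
Variables (R : realType) (X : finType) (I : Type) (W : seq I).

Definition output_mass (j : X -> I -> R) (w : I) : R := \sum_x j x w.

Section Joint.
Variable j : X -> I -> R.
Hypothesis j_ge0 : forall x w, 0 <= j x w.
Let m := output_mass j.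

Lemma joint_le_sum x w : j x w <= m w.
Proof. by rewrite /m /output_mass (bigD1 x) //= lerDl sumr_ge0. Qed.

Lemma sum_joint_ge0 w : 0 <= m w.
Proof. exact: sumr_ge0. Qed.

(** Division by a null [m w] yields 0; the identity survives because [j x w], lying between 0 and
    [m w], vanishes too. *)
Lemma weighted_posterior x w : m w * (j x w / m w) = j x w.
Proof.
have [m0|m0] := eqVneq (m w) 0; last by rewrite mulrCA mulfV ?mulr1.
by rewrite m0 mul0r; apply/le_anti/andP; split; rewrite // -m0 joint_le_sum.
Qed.

Lemma posterior_ge0 x w : 0 <= j x w / m w.
Proof. by rewrite divr_ge0 ?sum_joint_ge0. Qed.

Lemma weighted_error_entropy_le w :
  m w * error_entropy (fun x => j x w / m w) <=
  ln 2 * (m w * shannon_entropy (fun x => j x w / m w)).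
Proof.
rewrite mulrCA; have [->|m0] := eqVneq (m w) 0; first by rewrite !mul0r.
apply: ler_wpM2l; first exact: sum_joint_ge0.
apply: error_entropy_le => [x|]; first exact: posterior_ge0.
by rewrite -mulr_suml -/(output_mass j w) mulfV.
Qed.

Lemma weighted_shannon_entropy w :
  ln 2 * (m w * shannon_entropy (fun x => j x w / m w)) =
  - \sum_x j x w * ln (j x w / m w).
Proof.
rewrite mulrCA ln2_shannon_entropy mulrN mulr_sumr; congr (- _).
by apply: eq_bigr => x _; rewrite mulrA weighted_posterior.
Qed.

(** The logarithm bound leaves [Num.sqrt (m w) - Num.sqrt (j x w)], which subadditivity of the
    square root bounds by the roots of the other joint masses. Multiplied by [Num.sqrt (j x w)],
    these are the cross terms. *)
Lemma equivocation_le w :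
  ln 2 * (m w * shannon_entropy (fun x => j x w / m w)) <=
  2 * \sum_x \sum_(x' | x' != x) Num.sqrt (j x w * j x' w).
Proof.
rewrite weighted_shannon_entropy -sumrN mulr_sumr; apply: ler_sum => x _.
have [j0|jN0] := eqVneq (j x w) 0.
  rewrite j0 mul0r oppr0 mulr_ge0 // sumr_ge0 // => x' _; exact: sqrtr_ge0.
have jx0 : 0 < j x w by rewrite lt_def jN0 j_ge0.
have m0 : 0 < m w by apply: lt_le_trans (joint_le_sum x w).
have sj0 : 0 < Num.sqrt (j x w) by rewrite sqrtr_gt0.
have sm0 : 0 < Num.sqrt (m w) by rewrite sqrtr_gt0.
have subadd : Num.sqrt (m w) <=
    Num.sqrt (j x w) + \sum_(x' | x' != x) Num.sqrt (j x' w).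
  by apply: le_trans (sqrt_sum_le _ _) _ => //; rewrite (bigD1 x).
have -> : \sum_(x' | x' != x) Num.sqrt (j x w * j x' w) =
    Num.sqrt (j x w) * \sum_(x' | x' != x) Num.sqrt (j x' w).
  by rewrite mulr_sumr; apply: eq_bigr => x' _; rewrite sqrtrM.
(* ln (m / j) = 2 ln (sqrt m / sqrt j) <= 2 (sqrt m / sqrt j - 1) *)
have -> : j x w * ln (j x w / m w) =
    - (2 * (j x w * ln (Num.sqrt (m w) / Num.sqrt (j x w)))).
  rewrite !ln_div ?posrE // (ln_sqrtr jx0) (ln_sqrtr m0); ring.
rewrite opprK ler_wpM2l //.
apply: le_trans (ler_wpM2l (ltW jx0) (ln_le_sub1 (divr_gt0 sm0 sj0))) _.
rewrite -{1}(sqr_sqrtr (ltW jx0)) expr2 -mulrA ler_wpM2l ?(ltW sj0) //.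
by rewrite mulrBr mulr1 mulrCA mulfV ?gt_eqF // mulr1; lra.
Qed.

End Joint.

(** * Upper bounds when the likelihood factors through representatives *)

Section UpperBounds.
Variables (p : fdist R X) (L : X -> I -> R) (T : {set X}) (rep : X -> X).
Hypothesis L_ge0 : forall x w, 0 <= L x w.
Hypothesis L_sum1 : forall x, \sum_(w <- W) L x w = 1.
Hypothesis rep_mem : forall x, rep x \in T.
Hypothesis L_rep : forall x w, L (rep x) w = L x w.
Let j x w := p x * L x w.
Let m := output_mass j.

Let j_ge0 x w : 0 <= j x w.
Proof. by rewrite /j mulr_ge0 ?Defs.pmf_ge0. Qed.

Let j_sum x : \sum_(w <- W) j x w = p x.
Proof. by rewrite /j -mulr_sumr L_sum1 mulr1. Qed.

Let m_sum : \sum_(w <- W) m w = 1.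
Proof.
by rewrite exchange_big -(pmf_sum1 p); apply: eq_bigr => x _; apply: j_sum.
Qed.

Let card_gt0 : (0 < #|T|)%N.
Proof.
case: (pickP (@predT X)) => [x _|X0]; first by apply/card_gt0P; exists (rep x).
have := pmf_sum1 p; rewrite big_pred0 // => /eqP.
by rewrite eq_sym oner_eq0.
Qed.

Let K : R := #|T|%:R.

Let K_gt0 : 0 < K. Proof. by rewrite ltr0n card_gt0. Qed.

Let sum_reps : \sum_(w <- W) \sum_(t in T) L t w = K.
Proof.
rewrite exchange_big (eq_bigr (fun=> 1)) => [|t _]; last exact: L_sum1.
by rewrite sumr_const.
Qed.

(** Group the inputs by representative: the fibre of [t] contributes [L t w] times its posterior
    probability, which is at most 1. *)
Let chi_square_le w : \sum_x j x w * (L x w / m w) <= \sum_(t in T) L t w.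
Proof.
have m0 : 0 <= m w by apply: sumr_ge0.
rewrite (partition_big rep (mem T)) => [|x _]; last exact: rep_mem.
apply: ler_sum => t _.
rewrite (eq_bigr (fun x => j x w * (L t w / m w))) => [|x /eqP <-]; last first.
  by rewrite L_rep.
rewrite -mulr_suml mulrCA -[leRHS]mulr1 ler_wpM2l //.
have [->|mN0] := eqVneq (m w) 0; first by rewrite invr0 mulr0.
rewrite ler_pdivrMr ?lt_def ?mN0 // mul1r /m /output_mass.
rewrite [leRHS](bigID (fun x => rep x == t)).
by rewrite lerDl sumr_ge0.
Qed.

Lemma mutual_information_le :
  shannon_entropy p - \sum_(w <- W) m w * shannon_entropy (fun x => j x w / m w)
    <= log2 K.
Proof.
rewrite -(ler_pM2l (ln2_gt0 R)) mulrBr mulr_sumr ln2_shannon_entropy.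
rewrite [leRHS]mulrC divfK ?gt_eqF ?ln2_gt0 //.
rewrite [X in _ - X](eq_bigr _ (fun w _ => weighted_shannon_entropy j_ge0 w)).
rewrite sumrN opprK.
have -> : \sum_x p x * ln (p x) = \sum_(w <- W) \sum_x j x w * ln (p x).
  by rewrite exchange_big; apply: eq_bigr => x _; rewrite -mulr_suml j_sum.
rewrite -[leRHS]mul1r -m_sum mulr_suml addrC -sumrB.
(* The chi-square sums total at most [K], by [chi_square_le] and [sum_reps], and [m] has mass 1. The
   goal then follows by comparing the two sums term by term. *)
have : \sum_(w <- W) (K^-1 * \sum_x j x w * (L x w / m w) - m w) <= 0.
  rewrite sumrB m_sum -mulr_sumr subr_le0 mulrC ler_pdivrMr // mul1r -sum_reps.
  by apply: ler_sum => w _; apply: chi_square_le.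
rewrite -subr_le0 -sumrB; apply: le_trans.
apply: ler_sum => w _; rewrite mulr_sumr {2 3}/m /output_mass mulr_suml -!sumrB.
apply: ler_sum => x _; rewrite -/(output_mass j w) -/(m w).
have [->|jN0] := eqVneq (j x w) 0; first by rewrite !mul0r mulr0 !subr0.
have jx0 : 0 < j x w by rewrite lt_def jN0 j_ge0.
have m0 : 0 < m w by apply: lt_le_trans (joint_le_sum j_ge0 x w).
have [p0 L0] : 0 < p x /\ 0 < L x w.
  by move: jN0;
    rewrite mulf_eq0 negb_or !lt_def Defs.pmf_ge0 L_ge0 => /andP[-> ->].
(* This is the argument of the inequality [ln t <= t - 1]: since [j = p L], the posterior divided by
   [p x] and [K] is [L / (m K)]. *)
have t0 : 0 < L x w / m w / K by rewrite !divr_gt0.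
have -> : j x w * ln (j x w / m w) - j x w * ln (p x) - j x w * ln K =
    j x w * ln (L x w / m w / K).
  by rewrite !ln_div ?posrE ?divr_gt0 // lnM ?posrE //; ring.
apply: le_trans (ler_wpM2l (j_ge0 x w) (ln_le_sub1 t0)) _.
by rewrite mulrBr mulr1 lerD2r [leLHS]mulrA [leLHS]mulrC.
Qed.

Lemma error_reduction_le :
  error_entropy p - \sum_(w <- W) m w * error_entropy (fun x => j x w / m w)
    <= 1 - 1 / K.
Proof.
rewrite /error_entropy; set P := \big[_/_]_x p x.
have P0 : 0 <= P by apply: bigmax_ge_id.
(* In effect [v w] is the largest [j x w]: the factor [m w] cancels the division, and for a null
   outcome both are 0. *)
pose v w := m w * \big[Num.max/0]_x (j x w / m w).
have m_ge0 w : 0 <= m w by apply: sumr_ge0.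
have -> : \sum_(w <- W) m w * (1 - \big[Num.max/0]_x (j x w / m w)) =
    1 - \sum_(w <- W) v w.
  rewrite -[X in _ = X - _]m_sum -sumrB; apply: eq_bigr => w _.
  by rewrite mulrBr mulr1.
have v_le w b : 0 <= b -> (forall x, j x w <= b) -> v w <= b.
  move=> b0 jb; rewrite /v; have [->|mN0] := eqVneq (m w) 0.
    by rewrite mul0r.
  have m0 : 0 < m w by rewrite lt_def mN0 m_ge0.
  rewrite mulrC -ler_pdivlMr //; apply: bigmax_le => [|x _].
    by rewrite divr_ge0.
  by rewrite ler_pM2r ?invr_gt0.
have V1 : \sum_(w <- W) v w <= 1.
  rewrite -m_sum; apply: ler_sum => w _; apply: v_le => // x.
  exact: joint_le_sum.
(* Each [j x w] is at most [P * L (rep x) w], hence at most [P] times the sum over [T], whose total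
   over all outcomes is [K]. *)
have VK : \sum_(w <- W) v w <= P * K.
  rewrite -sum_reps mulr_sumr; apply: ler_sum => w _.
  apply: v_le => [|x]; first by rewrite mulr_ge0 ?sumr_ge0.
  apply: (@le_trans _ _ (P * L x w)).
    by rewrite ler_wpM2r //; apply: le_bigmax.
  by rewrite -L_rep ler_wpM2l // (bigD1 (rep x)) //= lerDl sumr_ge0.
have : 1 <= K by rewrite ler1n.
move: V1 VK; set V := \sum_(w <- W) v w => V1 VK K1.
have PV : V / K <= P by rewrite ler_pdivrMr.
(* With this product and [V / K <= P], the remaining goal [V - P <= 1 - 1 / K] is linear once
   [V / K] counts as an atom. *)
have : (1 - V) * (1 - K^-1) >= 0.
  by rewrite mulr_ge0 ?subr_ge0 // invf_le1.
by rewrite div1r; lra.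
Qed.

End UpperBounds.

End Channel.

(** * Enumeration of words by length *)

Section Words.
Variable Y : finType.

(** Words grow at the right end, as a history does when a new output arrives. *)
Fixpoint words (n : nat) : seq (seq Y) :=
  if n is n'.+1 then [seq rcons w y | w <- words n', y <- enum Y]
  else [:: [::]].

Fixpoint words_upto (n : nat) : seq (seq Y) :=
  if n is n'.+1 then words_upto n' ++ words n else words 0.

Lemma mem_words n w : (w \in words n) = (size w == n).
Proof.
elim: n w => [|n IH] w /=; first by rewrite inE size_eq0.
apply/allpairsP/idP => [[[u y] /= [un _ ->]]|].
  by rewrite size_rcons eqSS -IH.
case/lastP: w => // w y; rewrite size_rcons eqSS -IH => wn.
by exists (w, y); rewrite mem_enum.
Qed.

Lemma words_uniq n : uniq (words n).
Proof.
elim: n => //= n IH; apply: allpairs_uniq => //; first exact: enum_uniq.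
by move=> [u y] [v z] _ _ /= /rcons_inj[-> ->].
Qed.

Lemma mem_words_upto n w : (w \in words_upto n) = (size w <= n)%N.
Proof.
elim: n => [|n IH]; first by rewrite /= inE leqn0 size_eq0.
rewrite [words_upto _]/(words_upto n ++ words n.+1) mem_cat IH mem_words.
by rewrite (leq_eqVlt _ n.+1) orbC.
Qed.

Lemma words_upto_uniq n : uniq (words_upto n).
Proof.
elim: n => // n IH; rewrite [words_upto _]/(words_upto n ++ words n.+1).
rewrite cat_uniq IH words_uniq andbT; apply/hasPn => w.
by rewrite mem_words mem_words_upto => /eqP ->; rewrite ltnn.
Qed.

Lemma big_words_rec (R : realType) n (F : seq Y -> R) :
  \sum_(w <- words n.+1) F w = \sum_(w <- words n) \sum_y F (rcons w y).
Proof.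
by rewrite /= big_allpairs_dep; apply: eq_bigr => w _; rewrite big_enum.
Qed.

Lemma big_words_upto_rec (R : realType) n (F : seq Y -> R) :
  \sum_(w <- words_upto n.+1) F w =
  \sum_(w <- words_upto n) F w + \sum_(w <- words n.+1) F w.
Proof. exact: big_cat. Qed.

End Words.

(** * Law of the outcome given the input *)

Section Likelihood.
Variables (R : realType) (X Y Act : finType) (S : mechanism R X Y Act).
Variable sigma : strategy Y Act.

Definition transition (x : X) (w : seq Y) (y : Y) : R :=
  if sigma w is Some a then chan S a x y else 0.

Definition path_prob (x : X) (w : seq Y) : R :=
  \prod_(i < size w) step_prob S sigma x i.

(** The histories at which play stops; this is the support condition of [joint]. *)
Definition leaf (w : seq Y) : bool :=
  [&& w != [::], isSome (sigma (take (size w).-1 w)) & ~~ isSome (sigma w)].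

Definition likelihood (x : X) (w : seq Y) : R :=
  if leaf w then path_prob x w else 0.

(** The index type ['I_(size w)] depends on the word; natural indices allow the last factor to be
    split off. *)
Lemma path_prob_nat x w y :
  path_prob x w =
  \prod_(0 <= i < size w) transition x (take i w) (nth y w i).
Proof.
rewrite big_mkord; apply: eq_bigr => i _.
by rewrite /step_prob /transition (tnth_nth y).
Qed.

Lemma path_prob_rcons x w y :
  path_prob x (rcons w y) = path_prob x w * transition x w y.
Proof.
rewrite !(path_prob_nat _ _ y) size_rcons big_nat_recr //=; congr (_ * _).
  apply: eq_big_nat => i /andP[_ iw].
  by rewrite nth_rcons iw -cats1 take_cat iw.
by rewrite nth_rcons ltnn eqxx -cats1 take_size_cat.
Qed.

Lemma transition_ge0 x w y : 0 <= transition x w y.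
Proof.
by rewrite /transition; case: (sigma w) => // a; exact: Defs.pmf_ge0.
Qed.

Lemma path_prob_ge0 x w : 0 <= path_prob x w.
Proof.
elim/last_ind: w => [|w y IH]; first by rewrite /path_prob big_ord0.
by rewrite path_prob_rcons mulr_ge0 ?transition_ge0.
Qed.

Lemma likelihood_ge0 x w : 0 <= likelihood x w.
Proof. by rewrite /likelihood; case: ifP => // _; exact: path_prob_ge0. Qed.

Lemma joint_likelihood p x w : joint S p sigma x w = p x * likelihood x w.
Proof.
by rewrite /joint /likelihood /leaf; case: ifP => // _; rewrite mulr0.
Qed.

Lemma likelihood_indist x x' w :
  indist S x x' -> likelihood x w = likelihood x' w.
Proof.
move=> /forallP xx'; rewrite /likelihood; case: ifP => // _.
apply: eq_bigr => i _; rewrite /step_prob; case: (sigma _) => // a.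
exact/eqP/(forallP (xx' a)).
Qed.

Lemma likelihood_dom x w : isSome (sigma w) -> likelihood x w = 0.
Proof. by rewrite /likelihood /leaf => ->; rewrite !andbF. Qed.

Lemma sigma_nil : isSome (sigma [::]).
Proof.
have [w sw] := strategy_nonempty sigma.
exact: strategy_prefix_closed (prefix0s w) sw.
Qed.

(** An extended history either continues or stops there. If play had stopped earlier, so that [w] is
    outside the domain, the last transition is 0 and all terms vanish. *)
Lemma path_prob_split x w y :
  path_prob x (rcons w y) = likelihood x (rcons w y) +
    (if isSome (sigma (rcons w y)) then path_prob x (rcons w y) else 0).
Proof.
have [sw|sw] := boolP (isSome (sigma (rcons w y))).
  by rewrite likelihood_dom // add0r.
have tw : take (size w) (rcons w y) = w by rewrite -cats1 take_size_cat.
rewrite addr0 /likelihood /leaf size_rcons /= tw sw andbT.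
have -> : rcons w y != [::] by rewrite -size_eq0 size_rcons.
case: ifP => //= sw'; rewrite path_prob_rcons /transition.
by case: (sigma w) sw' => // _; rewrite mulr0.
Qed.

(** Conservation of mass: what has stopped by depth [n] plus what is still running. At each step a
    running history distributes its mass over the next letters by a stochastic row. *)
Lemma likelihood_mass x n :
  \sum_(w <- words_upto Y n) likelihood x w +
  \sum_(w <- words Y n | isSome (sigma w)) path_prob x w = 1.
Proof.
elim: n => [|n IH].
  rewrite /= big_seq1 likelihood_dom ?sigma_nil // add0r big_cons big_nil.
  by rewrite sigma_nil /path_prob big_ord0 addr0.
rewrite big_words_upto_rec -addrA -[RHS]IH; congr (_ + _).
rewrite [X in _ + X]big_mkcond -big_split /= big_words_rec [RHS]big_mkcond /=.
apply: eq_bigr => w _; under eq_bigr do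
  rewrite -path_prob_split path_prob_rcons.
rewrite -mulr_sumr /transition; case: (sigma w) => [a|] /=.
  by rewrite pmf_sum1 mulr1.
by rewrite big1 // mulr0.
Qed.

Definition bounded_depth (n : nat) : Prop :=
  forall w, isSome (sigma w) -> (size w < n)%N.

Lemma finite_strategy_bounded_depth :
  finite_strategy sigma -> exists n, bounded_depth n.
Proof.
move=> /finite_seqP[s sE]; exists (\max_(w <- s) size w).+1 => w sw.
have ws : w \in s by have : strategy_dom sigma w by []; rewrite sE.
by rewrite ltnS (leq_bigmax_seq w).
Qed.

Lemma likelihood_sum1 n x : bounded_depth n ->
  \sum_(w <- words_upto Y n) likelihood x w = 1.
Proof.
move=> bn; rewrite -[RHS](likelihood_mass x n) [X in _ + X]big_seq_cond.
rewrite big_pred0 ?addr0 // => w; rewrite mem_words.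
by apply/negP => /andP[/eqP wn /bn]; rewrite wn ltnn.
Qed.

(** An explicit list of words makes sums exchangeable. Null outcomes may be included, as their
    weight is 0. *)
Lemma finite_leakage_words U (p : fdist R X) n : bounded_depth n ->
  let j := fun x w => p x * likelihood x w in
  finite_leakage U S p sigma =
  U p - \sum_(w <- words_upto Y n)
           output_mass j w * U (fun x => j x w / output_mass j w).
Proof.
move=> bn j; have jE : joint S p sigma = j.
  by apply/funext => x; apply/funext => w; exact: joint_likelihood.
have mE : marginal S p sigma = output_mass j by rewrite -jE.
have m_ge0 w : 0 <= output_mass j w.
  apply: sumr_ge0 => x _; rewrite mulr_ge0 ?Defs.pmf_ge0 //.
  exact: likelihood_ge0.
rewrite /finite_leakage /conditional mE jE; congr (_ - _).
rewrite (@fsbigE _ _ _ _ _ [seq w <- words_upto Y n | 0 < output_mass j w]).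
- rewrite big_filter_cond big_mkcond; apply: eq_bigr => w _.
  case: ifPn => //; rewrite mem_setE andbb -leNgt => m_le0.
  by rewrite (@le_anti _ _ (output_mass j w) 0) ?mul0r // m_le0 m_ge0.
- by rewrite filter_uniq ?words_upto_uniq.
- by move=> w /=; rewrite mem_filter => /andP[].
(* A word longer than [n] is not a leaf: its parent has length at least [n] and so lies outside the
   domain. *)
move=> w /= mw; rewrite mem_filter mw mem_words_upto /= => wn.
suff : output_mass j w = 0 by move=> ->; rewrite mul0r.
apply: big1 => x _; rewrite /j /likelihood; case: ifP; last by rewrite mulr0.
move=> /and3P[wN0 /bn]; rewrite size_take ltn_predL lt0n size_eq0 wN0.
by rewrite prednK ?lt0n ?size_eq0 // (negPf wn).
Qed.

End Likelihood.

(** * From finite strategies to the capacity *)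

Section Leakage.
Variables (R : realType) (X Y Act : finType) (S : mechanism R X Y Act).
Implicit Types (U : (X -> R) -> R) (p : fdist R X).

Lemma restrict_bounded_depth (sigma : strategy Y Act) n :
  bounded_depth (Defs.restrict sigma n) n.+1.
Proof. by move=> w /=; rewrite /restrict_fun ltnS; case: ifP. Qed.

(* A divergent sequence would have the junk limit 0, whence the sign condition
   on the bound; convergence itself is not needed. *)
Lemma leakage_le U p (sigma : strategy Y Act) b : 0 <= b ->
  (forall (tau : strategy Y Act) n, bounded_depth tau n ->
     finite_leakage U S p tau <= b) ->
  leakage U S p sigma <= b.
Proof.
move=> b0 le_b; rewrite /leakage; case: asboolP => [|_].
  by move=> /finite_strategy_bounded_depth[n] /le_b.
have [cv|dv] :=
  pselect (cvgn (fun l => finite_leakage U S p (Defs.restrict sigma l))).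
  apply: limr_le => //; apply: nearW => n.
  exact/le_b/restrict_bounded_depth.
by rewrite dvgP.
Qed.

Lemma bounded_depth_finite (sigma : strategy Y Act) n :
  bounded_depth sigma n -> finite_strategy sigma.
Proof.
move=> bn; apply: (@sub_finite_set _ _ [set` words_upto Y n]) => //= w sw.
by rewrite /= mem_words_upto ltnW // bn.
Qed.

Lemma capacity_le U b : 0 <= b ->
  (forall p (tau : strategy Y Act) n, bounded_depth tau n ->
     finite_leakage U S p tau <= b) ->
  (capacity U S <= b%:E)%E.
Proof.
move=> b0 le_b; apply: ge_ereal_sup => _ [p _ <-].
apply: ge_ereal_sup => _ [sigma _ <-].
rewrite lee_fin; apply: leakage_le => // tau n; exact: le_b.
Qed.

Lemma finite_leakage_le_capacity U p (sigma : strategy Y Act) n :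
  bounded_depth sigma n -> ((finite_leakage U S p sigma)%:E <= capacity U S)%E.
Proof.
move=> bn; have fs := bounded_depth_finite bn.
apply: le_trans (ereal_sup_ubound _); last by exists p.
apply: le_trans (ereal_sup_ubound _); last by exists sigma.
by rewrite /leakage asboolT.
Qed.

End Leakage.

(** * Representatives of the indistinguishability classes *)

Section Classes.
Variables (R : realType) (X Y Act : finType) (S : mechanism R X Y Act).

Lemma indist_equivalence : equivalence_rel (indist S).
Proof.
move=> x y z; split; first by apply/forallP => a; apply/forallP.
move=> /forallP xy; apply: eq_forallb => a; apply: eq_forallb => b.
by rewrite (eqP (forallP (xy a) b)).
Qed.

(** [T] is a transversal of the partition and [rep] picks its point in the block of [x]. The upper
    bounds use [rep], the lower bounds the distinguishability within [T]. *)
Lemma indist_representatives : exists (T : {set X}) (rep : X -> X),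
  [/\ #|T| = num_classes S, forall x, rep x \in T,
      forall x, indist S (rep x) x &
      {in T &, forall x y, indist S x y -> x = y}].
Proof.
have eqv : {in [set: X] & &, equivalence_rel (indist S)}.
  by move=> x y z _ _ _; exact: indist_equivalence.
have part := equivalence_partitionP eqv.
have trT := transversalP part.
set P := equivalence_partition _ _ in part trT.
set T := transversal P _ in trT.
have xP x : finset.pblock P x \in P.
  by rewrite pblock_mem // (cover_partition part).
have pb x y : (y \in finset.pblock P x) = indist S x y.
  by rewrite pblock_equivalence_partition.
exists T, (fun x => transversal_repr x T (finset.pblock P x)); split.
- exact: card_transversal trT.
- by move=> x; apply: (repr_mem_transversal trT).
- move=> x; rewrite -pb (transversal_reprK trT) // pb.
  by have [] := indist_equivalence x x x.
move=> x y xT yT; rewrite -pb => yx; apply: (pblock_inj trT) => //.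
have triv : finset.trivIset P by case/and3P: part.
by rewrite (same_pblock triv yx).
Qed.

End Classes.

(** * Bhattacharyya affinity of two distributions *)

Section Bhattacharyya.
Variables (R : realType) (Y : finType).
Implicit Types p q : fdist R Y.

Definition bhattacharyya p q : R := \sum_y Num.sqrt (p y * q y).

Lemma bhattacharyya_ge0 p q : 0 <= bhattacharyya p q.
Proof. by apply: sumr_ge0 => y _; exact: sqrtr_ge0. Qed.

(** Expand the square and use total mass 1. In this form, one minus the squared Hellinger distance,
    the bound by 1 and its strictness for distinct laws are visible. *)
Lemma bhattacharyyaE p q :
  bhattacharyya p q = 1 - 2^-1 * \sum_y (Num.sqrt (p y) - Num.sqrt (q y)) ^+ 2.
Proof.
have -> : \sum_y (Num.sqrt (p y) - Num.sqrt (q y)) ^+ 2 =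
    \sum_y (p y + q y - 2 * Num.sqrt (p y * q y)).
  apply: eq_bigr => y _; have p0 := Defs.pmf_ge0 p y.
  have q0 := Defs.pmf_ge0 q y.
  rewrite sqrtrM // -[in RHS](sqr_sqrtr p0) -[in RHS](sqr_sqrtr q0).
  by rewrite !sqrtr_sqr !ger0_norm ?sqrtr_ge0 //; ring.
rewrite sumrB big_split /= !pmf_sum1 -mulr_sumr -/(bhattacharyya p q); lra.
Qed.

Lemma bhattacharyya_le1 p q : bhattacharyya p q <= 1.
Proof.
rewrite bhattacharyyaE gerBl mulr_ge0 ?sumr_ge0 // => y _; exact: sqr_ge0.
Qed.

Lemma bhattacharyya_lt1 p q y : p y != q y -> bhattacharyya p q < 1.
Proof.
move=> pq; rewrite bhattacharyyaE gtrBl mulr_gt0 // (bigD1 y) //=.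
rewrite ltr_pwDl ?sumr_ge0 // => [|z _]; last exact: sqr_ge0.
by rewrite exprn_even_gt0 //= subr_eq0 eqr_sqrt ?Defs.pmf_ge0.
Qed.

End Bhattacharyya.

(** * Non-adaptive strategies and product affinities *)

Section OpenLoop.
Variables (R : realType) (X Y Act : finType) (S : mechanism R X Y Act).
Variables (act : nat -> Act) (N : nat).

(** The cutoff is inclusive: actions [act 0] to [act N] are played, and the leaves are the words of
    length [N.+1]. *)
Definition open_loop_fun (w : seq Y) : option Act :=
  if (size w <= N)%N then Some (act (size w)) else None.

Lemma open_loop_nonempty : exists w, isSome (open_loop_fun w).
Proof. by exists [::]. Qed.

Lemma open_loop_prefix_closed u w : prefix u w ->
  isSome (open_loop_fun w) -> isSome (open_loop_fun u).
Proof.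
rewrite /open_loop_fun => /size_prefix uw; case: (leqP (size w)) => // wN _.
by rewrite (leq_trans uw wN).
Qed.

Definition open_loop : strategy Y Act :=
  Strategy open_loop_nonempty open_loop_prefix_closed.

Lemma open_loop_bounded_depth : bounded_depth open_loop N.+1.
Proof. by move=> w /=; rewrite /open_loop_fun ltnS; case: ifP. Qed.

Let affinity x x' i := bhattacharyya (chan S (act i) x) (chan S (act i) x').

(** Actions depend on time only, so the outputs are independent given the input, and the affinity of
    product laws is the product of the affinities. *)
Lemma path_affinity x x' n : (n <= N.+1)%N ->
  \sum_(w <- words Y n)
    Num.sqrt (path_prob S open_loop x w * path_prob S open_loop x' w) =
  \prod_(i < n) affinity x x' i.
Proof.
elim: n => [|n IH] nN.
  by rewrite /= big_seq1 big_ord0 /path_prob !big_ord0 mulr1 sqrtr1.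
rewrite big_words_rec big_ord_recr -IH 1?ltnW //= mulr_suml.
rewrite big_seq [RHS]big_seq; apply: eq_bigr => w; rewrite mem_words => /eqP wn.
rewrite /affinity /bhattacharyya mulr_sumr; apply: eq_bigr => y _.
rewrite !path_prob_rcons mulrACA sqrtrM; last first.
  by rewrite mulr_ge0 ?path_prob_ge0.
by rewrite /transition /= /open_loop_fun wn -ltnS nN.
Qed.

Lemma likelihood_affinity_le x x' :
  \sum_(w <- words_upto Y N.+1)
    Num.sqrt (likelihood S open_loop x w * likelihood S open_loop x' w) <=
  \prod_(i < N.+1) affinity x x' i.
Proof.
rewrite -path_affinity // big_words_upto_rec big_seq big1 ?add0r => [|w].
  apply: ler_sum => w _; rewrite /likelihood; case: ifP => // _.
  by rewrite mulr0 sqrtr0 sqrtr_ge0.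
rewrite mem_words_upto => wN; rewrite likelihood_dom ?mul0r ?sqrtr0 //=.
by rewrite /open_loop_fun wN.
Qed.

End OpenLoop.

(** * Geometric decay under cyclic play *)

Section RoundRobin.
Variables (R : realType) (X Y Act : finType) (S : mechanism R X Y Act).
Variable a0 : Act.

Definition round_robin (i : nat) : Act := nth a0 (enum Act) (i %% #|Act|).

Lemma prod_round_robin (f : Act -> R) n :
  \prod_(i < n * #|Act|) f (round_robin i) = (\prod_a f a) ^+ n.
Proof.
elim: n => [|n IH]; first by rewrite mul0n big_ord0.
rewrite mulSn big_split_ord /= exprS -IH; congr (_ * _).
  rewrite -(big_enum _ _ _ f) (big_nth a0) big_mkord -cardE.
  by apply: eq_bigr => i _; rewrite /round_robin modn_small.
by apply: eq_bigr => i _; rewrite /round_robin modnDl.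
Qed.

(** Some action separates the two inputs and gives a factor below 1; the other factors of the cycle
    are at most 1. *)
Lemma prod_bhattacharyya_lt1 x x' : ~~ indist S x x' ->
  \prod_a bhattacharyya (chan S a x) (chan S a x') < 1.
Proof.
case/forallPn => a /forallPn[y pq]; rewrite (bigD1 a) //=.
apply: le_lt_trans (bhattacharyya_lt1 pq); rewrite -[leRHS]mulr1.
rewrite ler_wpM2l ?bhattacharyya_ge0 //; apply: prodr_ile1 => b _.
by rewrite bhattacharyya_ge0 bhattacharyya_le1.
Qed.

Lemma affinity_small eps : 0 < eps -> exists n, forall x x', ~~ indist S x x' ->
  \prod_(i < (n * #|Act|).+1)
    bhattacharyya (chan S (round_robin i) x) (chan S (round_robin i) x') <= eps.
Proof.
move=> eps0.
pose kappa x x' := \prod_a bhattacharyya (chan S a x) (chan S a x').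
have kappa_ge0 x x' : 0 <= kappa x x'.
  by apply: prodr_ge0 => a _; exact: bhattacharyya_ge0.
have : \forall n \near \oo%classic, forall xx' : X * X,
    ~~ indist S xx'.1 xx'.2 -> kappa xx'.1 xx'.2 ^+ n < eps.
  (* There are finitely many pairs, so a common [n] exists once each distinguishable pair is treated
     alone, where powers of [kappa x x' < 1] tend to 0. *)
  apply: filter_forall => -[x x'] /=.
  have [_|xx'] := boolP (indist S x x'); first exact: nearW.
  have k1 : `|kappa x x'| < 1 by rewrite ger0_norm ?prod_bhattacharyya_lt1.
  move/cvgr0_norm_lt: (cvg_expr k1) => /(_ eps eps0).
  apply: filterS => n; rewrite ger0_norm ?exprn_ge0 //.
case=> n _ /(_ n (leqnn n)) small; exists n => x x' xx'.
apply: le_trans (ltW (small (x, x') xx')) => /=.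
(* The inclusive horizon of [open_loop] adds one round after the [n] full cycles; its affinity is at
   most 1. *)
rewrite big_ord_recr /=.
rewrite -[leRHS]mulr1.
rewrite -(prod_round_robin (fun a => bhattacharyya _ (chan S a x'))).
by rewrite ler_wpM2l ?bhattacharyya_le1 ?prodr_ge0 // => i _;
   exact: bhattacharyya_ge0.
Qed.

End RoundRobin.

(** * Uniform prior on a set and its entropies *)

Section Uniform.
Variables (R : realType) (X : finType) (T : {set X}).
Hypothesis T_gt0 : (0 < #|T|)%N.

Definition uniform_fun (x : X) : R := if x \in T then #|T|%:R^-1 else 0.

Lemma uniform_fun_ge0 x : 0 <= uniform_fun x.
Proof. by rewrite /uniform_fun; case: ifP; rewrite ?invr_ge0. Qed.

Lemma uniform_fun_sum1 : \sum_x uniform_fun x = 1.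
Proof.
rewrite -big_mkcond sumr_const -[LHS]mulr_natl mulfV //.
by rewrite pnatr_eq0 -lt0n.
Qed.

Definition uniform : fdist R X := FDist uniform_fun_ge0 uniform_fun_sum1.

Lemma shannon_entropy_uniform : shannon_entropy uniform = log2 #|T|%:R.
Proof.
have K0 : 0 < #|T|%:R :> R by rewrite ltr0n.
apply: (mulfI (lt0r_neq0 (ln2_gt0 R))); rewrite ln2_shannon_entropy.
rewrite [RHS]mulrC divfK ?gt_eqF ?ln2_gt0 //.
rewrite (bigID (mem T)) /= [X in _ + X]big1 ?addr0 => [|x xT]; last first.
  by rewrite /uniform_fun (negPf xT) mul0r.
rewrite (eq_bigr (fun=> #|T|%:R^-1 * ln #|T|%:R^-1)) => [|x xT]; last first.
  by rewrite /uniform_fun xT.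
rewrite sumr_const lnV ?posrE // -(mulr_natl (_ * _)) mulrA.
by rewrite mulfV ?gt_eqF // mul1r opprK.
Qed.

Lemma error_entropy_uniform : error_entropy uniform = 1 - 1 / #|T|%:R.
Proof.
rewrite /error_entropy div1r; congr (1 - _); apply/le_anti/andP; split.
  apply: bigmax_le => [|x _ /=]; first by rewrite invr_ge0.
  by rewrite /uniform_fun; case: ifP; rewrite ?invr_ge0.
have /card_gt0P[t tT] := T_gt0.
have <- : uniform t = #|T|%:R^-1 by rewrite /= /uniform_fun tT.
exact: le_bigmax.
Qed.

End Uniform.

(** * Lower bounds from the uniform prior on representatives *)

Section LowerBound.
Variables (R : realType) (X Y Act : finType) (S : mechanism R X Y Act).
Variable T : {set X}.
Hypothesis T_gt0 : (0 < #|T|)%N.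
Hypothesis T_dist : {in T &, forall x y, indist S x y -> x = y}.

(** Measured in nats: with the factor [ln 2] the sum also dominates the residual error probability,
    so one estimate serves both capacities. *)
Lemma equivocation_small eps : 0 < eps ->
  exists (sigma : strategy Y Act) n, bounded_depth sigma n /\
    let j := fun x w => uniform R T_gt0 x * likelihood S sigma x w in
    \sum_(w <- words_upto Y n) ln 2 *
      (output_mass j w * shannon_entropy (fun x => j x w / output_mass j w))
    <= eps.
Proof.
move=> eps0; have [a0 _] := card_gt0P (actions_nonempty S).
have [x0 _] := card_gt0P (inputs_nonempty S).
pose q : R := #|X|%:R; have q0 : 0 < q.
  by rewrite ltr0n; apply/card_gt0P; exists x0.
(* Each of the [q ^+ 2] ordered pairs of inputs gets an equal share of [eps]; the 2 is the constant
   of [equivocation_le]. *)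
have d0 : 0 < eps / (2 * q ^+ 2) by rewrite divr_gt0 // mulr_gt0 ?exprn_gt0.
have [n small] := affinity_small S a0 d0.
exists (open_loop Y (round_robin a0) (n * #|Act|)), (n * #|Act|).+1.
split=> [|j]; first exact: open_loop_bounded_depth.
have j_ge0 x w : 0 <= j x w.
  by rewrite /j mulr_ge0 ?Defs.pmf_ge0 ?likelihood_ge0.
apply: le_trans (ler_sum _ (fun w _ => equivocation_le j_ge0 w)) _.
rewrite -mulr_sumr exchange_big /=.
have -> : eps = 2 * \sum_(x : X) \sum_(x' : X) eps / (2 * q ^+ 2).
  rewrite !sumr_const -(mulr_natr (_ *+ _)) -(mulr_natr (_ / _)) -/q.
  by field; rewrite gt_eqF.
rewrite ler_wpM2l //; apply: ler_sum => x _; rewrite exchange_big /= big_mkcond.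
apply: ler_sum => x' _; case: ifP => [x'x|_]; last exact: ltW.
have u1 z : uniform R T_gt0 z <= 1.
  rewrite -(pmf_sum1 (uniform R T_gt0)) (bigD1 z) //= lerDl.
  by apply: sumr_ge0 => t _; exact: uniform_fun_ge0.
(* Inputs outside [T] have prior 0; the remaining pairs are distinct representatives, hence
   distinguishable. *)
have [xT|xT] := boolP (x \in T); last first.
  rewrite big1 ?ltW // => w _.
  by rewrite /j /= /uniform_fun (negPf xT) !mul0r sqrtr0.
have [x'T|x'T] := boolP (x' \in T); last first.
  rewrite big1 ?ltW // => w _.
  by rewrite /j /= /uniform_fun (negPf x'T) mul0r mulr0 sqrtr0.
have xx' : ~~ indist S x x'.
  by apply: contra x'x => /(T_dist xT x'T) ->.
apply: le_trans (small _ _ xx').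
apply: le_trans (likelihood_affinity_le _ _ _ _ _).
apply: ler_sum => w _; apply: ler_wsqrtr; rewrite /j.
have L0 := likelihood_ge0 S _ _ w.
by apply: ler_pM; rewrite ?mulr_ge0 ?L0 ?Defs.pmf_ge0 // ler_piMl.
Qed.

Lemma shannon_capacity_ge :
  ((log2 #|T|%:R)%:E <= capacity (@shannon_entropy R X) S)%E.
Proof.
apply/lee_addgt0Pr => eps eps0.
(* The factor [ln 2] converts nats into the bits of [shannon_entropy]. *)
have [|sigma [n [bn /= small]]] := @equivocation_small (ln 2 * eps).
  by rewrite mulr_gt0 ?ln2_gt0.
apply: le_trans (leeD2r _
  (finite_leakage_le_capacity _ _ (uniform R T_gt0) bn)).
rewrite -EFinD lee_fin (finite_leakage_words _ _ _ bn) shannon_entropy_uniform.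
by move: small; rewrite -mulr_sumr ler_pM2l ?ln2_gt0 //; lra.
Qed.

Lemma error_capacity_ge :
  ((1 - 1 / #|T|%:R)%:E <= capacity (@error_entropy R X) S)%E.
Proof.
apply/lee_addgt0Pr => eps eps0.
have [sigma [n [bn /= small]]] := equivocation_small eps0.
apply: le_trans (leeD2r _
  (finite_leakage_le_capacity _ _ (uniform R T_gt0) bn)).
rewrite -EFinD lee_fin (finite_leakage_words _ _ _ bn) error_entropy_uniform.
set j := (fun x w => uniform R T_gt0 x * _ x w) in small *.
have j_ge0 x w : 0 <= j x w.
  by rewrite /j mulr_ge0 ?Defs.pmf_ge0 ?likelihood_ge0.
have := ler_sum (words_upto Y n) (fun w (_ : true) =>
  weighted_error_entropy_le j_ge0 w).
lra.
Qed.

End LowerBound.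

Theorem theorem5p6 (R : realType) (X Y Act : finType)
    (S : mechanism R X Y Act) :
  capacity (@shannon_entropy R X) S = (log2 (num_classes S)%:R)%:E /\
  capacity (@error_entropy R X) S = (1 - 1 / (num_classes S)%:R)%:E.
Proof.
have [T [rep [<- rep_mem rep_indist T_dist]]] := indist_representatives S.
have T_gt0 : (0 < #|T|)%N.
  have [x _] := card_gt0P (inputs_nonempty S).
  by apply/card_gt0P; exists (rep x).
have T1 : 1 <= #|T|%:R :> R by rewrite ler1n.
have L_rep (tau : strategy Y Act) x w :
    likelihood S tau (rep x) w = likelihood S tau x w.
  exact: likelihood_indist.
split; apply/le_anti/andP; split.
- apply: capacity_le => [|p tau n bn].
    by rewrite /log2 divr_ge0 ?ln_ge0 // ler1n.
  rewrite (finite_leakage_words _ _ _ bn).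
  exact: (mutual_information_le p (likelihood_ge0 S tau)
    (fun x => likelihood_sum1 S x bn) rep_mem (L_rep tau)).
- exact: shannon_capacity_ge.
- apply: capacity_le => [|p tau n bn].
    by rewrite div1r subr_ge0 invf_le1 // ltr0n.
  rewrite (finite_leakage_words _ _ _ bn).
  exact: (error_reduction_le p (likelihood_ge0 S tau)
    (fun x => likelihood_sum1 S x bn) rep_mem (L_rep tau)).
- exact: error_capacity_ge.
Qed.
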